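(* Let $(\mathcal{S},\mathcal{A},\boldsymbol{r},\mathcal{U},\boldsymbol{p}_0)$ be a robust MDP with an sa-rectangular compact uncertainty set $\mathcal{U}$. Then there exists a stationary deterministic policy that is $\epsilon$-Blackwell optimal for all $\epsilon>0$, i.e., there exists $\pi\in\Pi_{\sf SD}$ such that for all $\epsilon>0$ there exists $\gamma_\epsilon\in(0,1)$ with $$\min_{\boldsymbol{P}\in\mathcal{U}}(1-\gamma)R_\gamma(\pi,\boldsymbol{P})\ \ge\ \sup_{\pi'\in\Pi_{\sf S}}\ \min_{\boldsymbol{P}\in\mathcal{U}}(1-\gamma)R_\gamma(\pi',\boldsymbol{P})-\epsilon,\qquad\forall\,\gamma\in(\gamma_\epsilon,1).$$
   Context: A robust MDP (RMDP) is a tuple $(\mathcal{S},\mathcal{A},\boldsymbol{r},\mathcal{U},\boldsymbol{p}_0)$: $\mathcal{S}$ (states) and $\mathcal{A}$ (actions) are finite nonempty sets, $\boldsymbol{r}\in\mathbb{R}^{\mathcal{S}\times\mathcal{A}\times\mathcal{S}}$ is the reward function, the uncertainty set $\mathcal{U}\subset\Delta(\mathcal{S})^{\mathcal{S}\times\mathcal{A}}$ is a nonempty compact set of transition probabilities $\boldsymbol{P}=(\boldsymbol{p}_{sa})_{s,a}$, and $\boldsymbol{p}_0\in\Delta(\mathcal{S})$ is the initial distribution. The set $\mathcal{U}$ is sa-rectangular if $\mathcal{U}=\prod_{(s,a)}\mathcal{U}_{sa}$ with $\mathcal{U}_{sa}\subseteq\Delta(\mathcal{S})$. $\Pi_{\sf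 S}$ is the set of stationary (possibly randomized) policies $\mathcal{S}\to\Delta(\mathcal{A})$, and $\Pi_{\sf SD}\subset\Pi_{\sf S}$ the finite set of stationary deterministic policies. For $\gamma\in(0,1)$, the discounted return is $$R_\gamma(\pi,\boldsymbol{P})=\mathbb{E}_{\pi,\boldsymbol{P}}\Big[\sum_{t=0}^{+\infty}\gamma^t r_{s_ta_ts_{t+1}}\ \Big|\ s_0\sim\boldsymbol{p}_0\Big],$$ where $\mathbb{E}_{\pi,\boldsymbol{P}}$ is expectation with respect to the law of $(s_t,a_t)_{t\ge 0}$ induced by $\pi$ and $\boldsymbol{P}$. *)

(* Defs.v *)
From HB Require Import structures.
From mathcomp Require Import all_boot all_order all_algebra.
From mathcomp Require Import all_classical all_reals all_analysis.

Set Implicit Arguments.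
Unset Strict Implicit.
Unset Printing Implicit Defensive.

Import Order.TTheory GRing.Theory Num.Theory numFieldNormedType.Exports.
Import ArrowAsProduct.

Local Open Scope classical_set_scope.
Local Open Scope ring_scope.

(* Finite nonempty sets: the library's measurable types must be pointed, hence
   pointed state and action types rather than a nonemptiness hypothesis. *)
#[short(type="finPointedType")]
HB.structure Definition FinPointed := {T of Finite T & Pointed T}.

Definition simplex {R : realType} {T : finType} : set (T -> R) :=
  [set p | (forall x, 0 <= p x) /\ \sum_x p x = 1].

(* The topology on S -> A -> S -> R is the product topology (ArrowAsProduct),
   i.e. the usual one on R^(S x A x S). *)
Record rmdp (R : realType) (S A : finPointedType) := RMDP {
  reward : S -> A -> S -> R ;
  uncertainty : set (S -> A -> S -> R) ;
  init_distr : S -> R ;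
  uncertainty_simplex :
    forall P, uncertainty P -> forall s a, simplex (P s a) ;
  uncertainty_nonempty : uncertainty !=set0 ;
  uncertainty_compact : @compact (S -> A -> S -> R)%type uncertainty ;
  init_simplex : simplex init_distr }.

Section rmdp_defs.
Context {R : realType} {S A : finPointedType}.
Implicit Types (pi : S -> A -> R) (P : S -> A -> S -> R).

Definition sa_rectangular (U : set (S -> A -> S -> R)) : Prop :=
  exists2 Usa : S -> A -> set (S -> R),
    (forall s a, Usa s a `<=` simplex) &
    U = [set P | forall s a, Usa s a (P s a)].

Definition stationary : set (S -> A -> R) :=
  [set pi | forall s, simplex (pi s)].

Definition stationary_deterministic : set (S -> A -> R) :=
  [set pi | stationary pi /\ forall s, exists a, pi s a = 1].

End rmdp_defs.

Section trajectories.
Context {S A : finPointedType}.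

Definition cylinder (n : nat) (h : nat -> S * A) : set (nat -> S * A) :=
  [set w | forall t, (t <= n)%N -> w t = h t].

Definition cylinders : set (set (nat -> S * A)) :=
  [set C | exists n h, C = cylinder n h].

End trajectories.

(* Sequences (s_t, a_t)_t with the product of the discrete sigma-algebras. *)
Definition trajectory (S A : finPointedType) :=
  g_sigma_algebraType (@cylinders S A).

HB.instance Definition _ (S A : finPointedType) :=
  Measurable.on (trajectory S A).

Section discounted_return.
Context {R : realType} {S A : finPointedType}.
Variables (p0 : S -> R) (pi : S -> A -> R) (P : S -> A -> S -> R).

Definition path_prob (n : nat) (h : nat -> S * A) : R :=
  p0 (h 0).1 * pi (h 0).1 (h 0).2 *
  \prod_(t < n) (P (h t).1 (h t).2 (h t.+1).1 * pi (h t.+1).1 (h t.+1).2).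

(* Cylinders determine a probability measure on trajectories, so that there is
   at most one such law; for stochastic p0, pi and P there is one, by
   [trajectory_law_cylinder], so that the default value of xget is not used. *)
Definition is_trajectory_law : set (probability (trajectory S A) R) :=
  [set mu | forall n h, mu (cylinder n h) = (path_prob n h)%:E].

Definition trajectory_law : probability (trajectory S A) R :=
  xget (dirac (point : trajectory S A) : probability _ R) is_trajectory_law.

Definition discounted_sum (r : S -> A -> S -> R) (gamma : R)
    (w : trajectory S A) : R :=
  limn (series (fun t => gamma ^+ t * r (w t).1 (w t).2 (w t.+1).1)).

Definition discounted_return (r : S -> A -> S -> R) (gamma : R) : R :=
  fine 'E_trajectory_law[discounted_sum r gamma].

End discounted_return.

Definition rmdp_return (R : realType) (S A : finPointedType) (M : rmdp R S A)
    (gamma : R) (pi : S -> A -> R) (P : S -> A -> S -> R) : R :=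
  discounted_return (init_distr M) pi P (reward M) gamma.

Definition is_min (R : realType) (E : set R) (m : R) : Prop :=
  E m /\ lbound E m.

(* Existence of the trajectory law, by pushing forward the uniform distribution
   on [0, 1[: given consistent weights W on finite histories, listed most recent
   item first, the history g is assigned the interval
   [left_end g, left_end g + W g[, and the intervals of its one-step extensions
   partition it. *)
Section law_of_a_sequence.
Context {R : realType} {T : finPointedType}.
Variable W : seq T -> R.
Hypothesis W_ge0 : forall g, 0 <= W g.
Hypothesis W_nil : W [::] = 1.
Hypothesis W_cons : forall g, \sum_x W (x :: g) = W g.

Fixpoint left_end (g : seq T) : R :=
  if g is x :: g' then
    left_end g' + \sum_(y | (enum_rank y < enum_rank x)%N) W (y :: g')
  else 0.

Let itv (g : seq T) : set R := `[left_end g, left_end g + W g[%classic.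

Let itvE g u : itv g u = (left_end g <= u) && (u < left_end g + W g) :> Prop.
Proof. by rewrite /itv/= in_itv. Qed.

Let csum g (n : nat) := \sum_(y | (enum_rank y < n)%N) W (y :: g).

Let csumS g x : csum g (enum_rank x).+1 = csum g (enum_rank x) + W (x :: g).
Proof.
rewrite /csum (bigD1 x)//= addrC; congr (_ + _); apply: eq_bigl => y.
rewrite ltnS ltn_neqAle andbC; congr (_ && _).
by rewrite -(inj_eq enum_rank_inj).
Qed.

Let csum_le g m n : (m <= n)%N -> csum g m <= csum g n.
Proof.
move=> mn; rewrite /csum [leRHS](bigID (fun y => enum_rank y < m)%N)/=.
rewrite (eq_bigl (fun y => (enum_rank y < n) && (enum_rank y < m)))%N.
  by rewrite lerDl; apply: sumr_ge0.
by move=> y; case: (ltnP (enum_rank y) m) => [/leq_trans->//|]; rewrite andbF.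
Qed.

Let csum0 g : csum g 0 = 0.
Proof. by rewrite /csum big_pred0. Qed.

Let csum_card g : csum g #|T| = W g.
Proof. by rewrite -W_cons; apply: eq_bigl => y; rewrite ltn_ord. Qed.

Let itv_consE x g u : itv (x :: g) u =
  ((left_end g + csum g (enum_rank x) <= u) &&
   (u < left_end g + csum g (enum_rank x).+1)) :> Prop.
Proof. by rewrite itvE csumS addrA. Qed.

Let itv_sub x g u : itv (x :: g) u -> itv g u.
Proof.
rewrite itv_consE itvE => /andP[h1 h2]; apply/andP; split.
  apply: le_trans h1; rewrite lerDl -(csum0 g); exact: csum_le.
apply: (lt_le_trans h2); rewrite lerD2l -csum_card; exact: csum_le.
Qed.

Let itv_inj x y g u : itv (x :: g) u -> itv (y :: g) u -> x = y.
Proof.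
have H z1 z2 : itv (z1 :: g) u -> itv (z2 :: g) u ->
    (enum_rank z2 <= enum_rank z1)%N.
  rewrite !itv_consE => /andP[_ h1] /andP[h2 _]; rewrite leqNgt; apply/negP => h.
  have := lt_le_trans h1 (le_trans _ h2); rewrite lerD2l => /(_ (csum_le _ h)).
  by rewrite ltxx.
move=> hx hy; apply: enum_rank_inj; apply/val_inj/eqP.
by rewrite eqn_leq !H.
Qed.

Let itv_ex g u : itv g u -> exists x, itv (x :: g) u.
Proof.
rewrite itvE => /andP[h1 h2].
have ex : exists n, u < left_end g + csum g n by exists #|T|; rewrite csum_card.
case: (ex_minnP ex) => -[|n]; first by rewrite csum0 addr0 ltNge h1.
move=> hn hmin.
have nT : (n < #|T|)%N by apply: hmin; rewrite csum_card.
exists (enum_val (Ordinal nT)); rewrite itv_consE enum_valK/= hn andbT.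
by rewrite leNgt; apply/negP => /hmin; rewrite ltnn.
Qed.

Fixpoint history (u : R) (n : nat) : seq T :=
  if n is n'.+1 then
    xget point [set x | itv (x :: history u n') u] :: history u n'
  else [::].

Definition sequence_of (u : R) (n : nat) : T := head point (history u n.+1).

Let size_history u n : size (history u n) = n.
Proof. by elim: n => //= n ->. Qed.

Let itv01 u : (0 <= u < 1) = itv [::] u :> Prop.
Proof. by rewrite itvE/= W_nil add0r. Qed.

Let itv_history u n : 0 <= u < 1 -> itv (history u n) u.
Proof.
move=> u01; elim: n => [|n IH]; first by rewrite -itv01.
by have [x hx] := itv_ex IH; rewrite /=; case: xgetP => [y -> //|/(_ x)].
Qed.

Let history_itv u g : itv g u -> history u (size g) = g.
Proof.
elim: g => //= x g IH h; rewrite (IH (itv_sub h)); congr (_ :: _).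
by case: xgetP => [y -> /= /itv_inj/(_ h)//|/(_ x)].
Qed.

Let itv_in01 u g : itv g u -> 0 <= u < 1.
Proof. by rewrite itv01; elim: g => // x g IH /itv_sub. Qed.

Definition rev_prefix (h : nat -> T) (n : nat) : seq T := rev (mkseq h n).

Let rev_prefixS h n : rev_prefix h n.+1 = h n :: rev_prefix h n.
Proof. by rewrite /rev_prefix mkseqS rev_rcons. Qed.

Let size_rev_prefix h n : size (rev_prefix h n) = n.
Proof. by rewrite size_rev size_mkseq. Qed.

Let sequence_of_history u h n :
  (forall t, (t <= n)%N -> sequence_of u t = h t) <->
  history u n.+1 = rev_prefix h n.+1.
Proof.
elim: n => [|n IH].
  rewrite rev_prefixS; split => [/(_ 0 isT)|]; rewrite /sequence_of/=.
    exact: (congr1 (fun x => [:: x])).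
  by move=> -[h0] t; rewrite leqn0 => /eqP ->.
rewrite rev_prefixS; split => [H|].
  rewrite -(IH.1 (fun t ht => H t (leqW ht))) -(H n.+1)//.
rewrite [history _ _.+2]/= => -[h1 h2] t.
rewrite leq_eqVlt ltnS => /predU1P[->|]; first by rewrite -h1.
by move: t; apply/IH.
Qed.

Let sequence_of_out u n : ~ (0 <= u < 1) -> sequence_of u n = point.
Proof. by move=> u01; rewrite /sequence_of/=; case: xgetP => // x _ /itv_in01. Qed.

Let preimage_sequence_of n h :
  sequence_of @^-1` [set w | forall t, (t <= n)%N -> w t = h t] `&` `[0, 1[ =
  itv (rev_prefix h n.+1).
Proof.
apply/seteqP; split=> u /=.
  by rewrite in_itv/= => -[/sequence_of_history <- ?]; exact: itv_history.
move=> h1; rewrite in_itv/=; split; last exact: itv_in01 h1.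
apply/sequence_of_history.
by rewrite -[in LHS](size_rev_prefix h n.+1); exact: history_itv.
Qed.

Let measurable_preimage n h :
  measurable (sequence_of @^-1` [set w | forall t, (t <= n)%N -> w t = h t]).
Proof.
rewrite -(setIT (_ @^-1` _)) -(setUv `[0, 1[) setIUr preimage_sequence_of.
apply: measurableU; first exact: measurable_itv.
have [hp|hp] := pselect (forall t, (t <= n)%N -> point = h t).
  rewrite (_ : _ `&` _ = ~` `[0, 1[%classic); first by
    apply: measurableC; exact: measurable_itv.
  apply/seteqP; split => [u []//|u /= hu]; split => // t tn.
  rewrite sequence_of_out; first exact: hp.
  by move=> u01; apply: hu; rewrite in_itv.
rewrite (_ : _ `&` _ = set0)//; apply/seteqP; split => // u /= [h1].
rewrite in_itv/= => h2; apply: hp => t tn.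
by rewrite -h1// sequence_of_out.
Qed.

Lemma sequence_law_exists (G : set (set (nat -> T))) :
  (forall C, G C ->
    exists n h, C = [set w | forall t, (t <= n)%N -> w t = h t]) ->
  exists mu : probability (g_sigma_algebraType G) R, forall n h,
    mu [set w | forall t, (t <= n)%N -> w t = h t] = (W (rev_prefix h n.+1))%:E.
Proof.
move=> GC.
have mf : measurable_fun setT
    (sequence_of : measurableTypeR R -> g_sigma_algebraType G).
  apply: (@measurability _ _ _ (g_sigma_algebraType G) setT _ G) => //.
  move=> _ [C /GC[n [h ->]] <-].
  by rewrite setTI; exact: measurable_preimage.
pose X : {mfun measurableTypeR R >-> g_sigma_algebraType G} :=
  mfun_Sub (mem_set mf).
pose U01 := uniform_prob (@ltr01 R).
exists (distribution U01 X) => n h.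
rewrite /distribution/= /pushforward/= /U01 /uniform_prob integral_uniform_pdf.
set B := _ @^-1` _.
have BE : B `&` `[0, 1[ = itv (rev_prefix h n.+1) by exact: preimage_sequence_of.
have mB : measurable (B `&` `[0, 1]%classic).
  apply: measurableI; [exact: measurable_preimage|exact: measurable_itv].
rewrite (eq_integral (cst 1%E)); last first.
  move=> u; rewrite inE => -[_]; rewrite /= in_itv/= /uniform_pdf => ->.
  by rewrite subr0 invr1.
rewrite integral_cst// mul1e -(setUitv1 true) ?bnd_simp// setIUr.
rewrite measureU0.
- transitivity (@lebesgue_measure R (itv (rev_prefix h n.+1))).
    by rewrite -BE.
  rewrite /itv lebesgue_measure_itv/= lte_fin ltrDl.
  rewrite -EFinB addrAC subrr add0r.
  by case: ltP => // W0; congr EFin; apply/eqP; rewrite eq_le W_ge0 W0.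
- by rewrite [X in measurable X]BE; exact: measurable_itv.
- by apply: measurableI => //; exact: measurable_preimage.
- apply/eqP; rewrite eq_le measure_ge0 andbT -(lebesgue_measure_set1 (1 : R)).
  apply: le_measure => //; rewrite inE//.
  by apply: measurableI => //; exact: measurable_preimage.
Qed.

End law_of_a_sequence.

HB.instance Definition _ (S A : finPointedType) := Pointed.on (S * A)%type.

Section trajectory_law_exists.
Context {R : realType} {S A : finPointedType}.
Variables (p0 : S -> R) (pi : S -> A -> R) (P : S -> A -> S -> R).
Hypothesis p0_simplex : simplex p0.
Hypothesis pi_simplex : forall s, simplex (pi s).
Hypothesis P_simplex : forall s a, simplex (P s a).

Fixpoint rev_path_prob (g : seq (S * A)) : R :=
  if g is x :: g' then
    (if g' is y :: _ then rev_path_prob g' * (P y.1 y.2 x.1 * pi x.1 x.2)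
     else p0 x.1 * pi x.1 x.2)
  else 1.

Let sum_step (q : S -> R) : simplex q ->
  \sum_(x : S * A) q x.1 * pi x.1 x.2 = 1.
Proof.
move=> [_ q1]; rewrite -(pair_bigA _ (fun s a => q s * pi s a))/= -q1.
by apply: eq_bigr => s _; rewrite -mulr_sumr (pi_simplex s).2 mulr1.
Qed.

Let rev_path_prob_ge0 g : 0 <= rev_path_prob g.
Proof.
elim: g => // x [_|y g IH].
  exact: mulr_ge0 (p0_simplex.1 _) ((pi_simplex _).1 _).
apply: mulr_ge0 => //.
exact: mulr_ge0 ((P_simplex _ _).1 _) ((pi_simplex _).1 _).
Qed.

Let rev_path_prob_cons g : \sum_x rev_path_prob (x :: g) = rev_path_prob g.
Proof.
case: g => [|y g]; first exact: sum_step.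
by rewrite -mulr_sumr (sum_step (P_simplex y.1 y.2)) mulr1.
Qed.

Let rev_path_probE h n :
  rev_path_prob (rev_prefix h n.+1) = path_prob p0 pi P n h.
Proof.
rewrite /path_prob; elim: n => [|n IH]; first by rewrite big_ord0 mulr1.
rewrite big_ord_recr/= mulrA -IH /rev_prefix.
by rewrite mkseqS rev_rcons mkseqS rev_rcons.
Qed.

Lemma trajectory_law_cylinder n h :
  trajectory_law p0 pi P (cylinder n h) = (path_prob p0 pi P n h)%:E.
Proof.
have [mu muE] := sequence_law_exists rev_path_prob_ge0 erefl rev_path_prob_cons
  (fun C (GC : @cylinders S A C) => GC).
rewrite /trajectory_law; case: xgetP => [nu _ ->//|/(_ mu)[]] k g.
by rewrite -rev_path_probE; exact: muE.
Qed.

End trajectory_law_exists.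

(* Main.v *)
Require Import Defs.
From HB Require Import structures.
From mathcomp Require Import all_boot all_order all_algebra.
From mathcomp Require Import all_classical all_reals all_analysis.
From mathcomp Require Import measurable_realfun ring lra.

Import Order.TTheory GRing.Theory Num.Theory numFieldNormedType.Exports.
Import ArrowAsProduct.
Local Open Scope classical_set_scope.
Local Open Scope ring_scope.

(* For a fixed discount factor g, the greedy policy of the robust Bellman
   optimality equation is a stationary deterministic policy that is optimal
   among all stationary policies, uniformly in the initial state. As there are
   finitely many deterministic policies, it is enough that the normalized robust
   value v_g of each of them converges as g tends to 1: a policy with the best
   limit is then epsilon-Blackwell optimal for every epsilon.

   For the convergence, let w be a cluster point of v_g. The Bellman inequality
   v_g <= (1 - g) c_P + g P v_g, valid for every kernel P, gives w <= P w in the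
   limit. If v_g is within e of w, then for g < g' a convex combination of v_g
   and w - e is a subsolution of the Bellman equation at g', whence
   w - e <= v_g'. So w - e is eventually a lower bound of v_g, for every cluster
   point w and every e > 0, and the cluster point is unique. *)

(** * Averages against a probability vector *)

Section averages.
Context {R : realType} {T : finType} (p : T -> R) (p_simplex : simplex p).
Implicit Types f g : T -> R.

Lemma ler_average f g : (forall x, f x <= g x) ->
  \sum_x p x * f x <= \sum_x p x * g x.
Proof. by move=> fg; apply: ler_sum => x _; rewrite ler_wpM2l// p_simplex.1. Qed.

Lemma average_shift (k : R) f :
  \sum_x p x * (f x + k) = \sum_x p x * f x + k.
Proof.
by under eq_bigr do rewrite mulrDr; rewrite big_split -mulr_suml p_simplex.2 mul1r.
Qed.

Lemma average_cst (c : R) : \sum_x p x * c = c.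
Proof. by rewrite -mulr_suml p_simplex.2 mul1r. Qed.

Lemma average_bound f (c : R) : (forall x, `|f x| <= c) ->
  `|\sum_x p x * f x| <= c.
Proof.
move=> fc; rewrite -(average_cst c); apply: le_trans (ler_norm_sum _ _ _) _.
by apply: ler_sum => x _; rewrite normrM ger0_norm ?ler_wpM2l ?p_simplex.1.
Qed.

Lemma average_lin (a b : R) f g :
  \sum_x p x * (a * f x + b * g x) =
  a * (\sum_x p x * f x) + b * (\sum_x p x * g x).
Proof.
rewrite !mulr_sumr -big_split; apply: eq_bigr => x _ /=.
by rewrite mulrDr !(mulrCA (p x)).
Qed.

End averages.

(* Knaster-Tarski gives a fixed point, and monotonicity together with the
   discounting of constants gives the comparison principle. *)
Section discounting_operators.
Context {R : realType} {S : finPointedType}.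

Definition discounting (g : R) (F : (S -> R) -> S -> R) : Prop :=
  (forall v u, (forall s, v s <= u s) -> forall s, F v s <= F u s) /\
  (forall v k s, 0 <= k -> F (fun t => v t + k) s <= F v s + g * k).

Lemma discounting_comparison (g : R) F (v u : S -> R) :
  discounting g F -> g < 1 ->
  (forall s, v s <= F v s) -> (forall s, F u s <= u s) -> forall s, v s <= u s.
Proof.
move=> [Fmono Fdisc] g1 vF Fu s; rewrite -subr_le0.
(* If the largest gap [k := v t - u t] were positive, then [v <= u + k] would give [v t <= F v t <=
   F (u + k) t <= F u t + g * k <= u t + g * k], so [k <= g * k], against [g < 1]. *)
pose t := [arg max_(i > s) (v i - u i)]%O.
have tmax i : v i - u i <= v t - u t.
  by rewrite /t; case: Order.TotalTheory.arg_maxP => // j _; apply.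
apply: le_trans (tmax s) _; rewrite leNgt; apply/negP => k0.
have vu i : v i <= u i + (v t - u t) by rewrite -lerBlDl.
have := le_trans (le_trans (vF t) (Fmono _ _ vu t)) (Fdisc u _ t (ltW k0)).
have := Fu t; nra.
Qed.

Lemma discounting_fixpoint (g b : R) F :
  discounting g F -> g < 1 ->
  (forall s, - b <= F (fun=> - b) s) -> (forall s, F (fun=> b) s <= b) ->
  exists v, (forall s, F v s = v s) /\ (forall s, `|v s| <= b).
Proof.
move=> Fd g1 Flo Fup; have Fmono := Fd.1.
(* The fixed point is the pointwise supremum [V] of all subsolutions. The constant [- b] is one of
   them, and comparison with the supersolution [b] bounds them all. *)
pose sub := [set v | forall s, v s <= F v s].
have subB v s : sub v -> v s <= b.
  by move=> vF; apply: (discounting_comparison _ _ v (fun=> b) Fd g1 vF Fup).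
pose V s := sup [set v s | v in sub].
have ubV s : has_ubound [set v s | v in sub].
  by exists b => _ [v vF <-]; exact: subB.
have leV v s : sub v -> v s <= V s.
  by move=> vF; apply: ub_le_sup => //; exists v.
have Vge s : - b <= V s by apply: (leV (fun=> - b)).
have V_sub : sub V.
  move=> s; apply: ge_sup => [|_ [v vF <-]].
    by exists (- b); exists (fun=> - b).
  by apply: le_trans (vF s) _; apply: Fmono => t; exact: leV.
exists V; split => s; last by rewrite ler_norml Vge subB.
(* By monotonicity [F V] is again a subsolution, hence lies below [V]. *)
by apply/eqP; rewrite eq_le V_sub andbT; apply: leV => t; exact: Fmono.
Qed.

End discounting_operators.

(** * Robust Bellman operators *)

Section bellman.
Context {R : realType} {S A : finPointedType} (r : S -> A -> S -> R).
Context {U : set (S -> A -> S -> R)}.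
Hypothesis U_simplex : forall P, U P -> forall s a, simplex (P s a).
Hypothesis U_nonempty : U !=set0.
Hypothesis U_compact : @compact (S -> A -> S -> R)%type U.
Hypothesis U_rect : sa_rectangular U.
Implicit Types (g k b e : R) (v u w : S -> R) (pi : S -> A -> R).
Implicit Types (P : S -> A -> S -> R).

(** Rewards carry the factor [1 - g], so that fixed points are normalized values, [1 - g] times the
    discounted return, and remain bounded as [g] tends to 1. *)
Definition action_value g P v s a : R :=
  \sum_s' P s a s' * ((1 - g) * r s a s' + g * v s').

Definition policy_op g pi P v s : R := \sum_a pi s a * action_value g P v s a.

Lemma action_value_monotone g P v u s a : U P -> 0 <= g ->
  (forall t, v t <= u t) -> action_value g P v s a <= action_value g P u s a.
Proof.
move=> UP g0 vu; apply: ler_average => [|t]; first exact: U_simplex.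
by rewrite lerD2l ler_wpM2l.
Qed.

Lemma action_value_shift g P v k s a : U P ->
  action_value g P (fun t => v t + k) s a = action_value g P v s a + g * k.
Proof.
move=> UP; rewrite -(average_shift _ (U_simplex _ UP s a)).
by apply: eq_bigr => t _; rewrite (mulrDr g) addrA.
Qed.

(** The summand is a convex combination of a reward and a value, which is why [b] can be the same
    for all discount factors. *)
Lemma action_value_bound g P v s a b : U P -> 0 <= g <= 1 ->
  (forall s a s', `|r s a s'| <= b) -> (forall t, `|v t| <= b) ->
  `|action_value g P v s a| <= b.
Proof.
move=> UP /andP[g0 g1] rb vb.
apply: (average_bound _ (U_simplex _ UP s a)) => t.
have := rb s a t; have := vb t; rewrite !ler_norml => /andP[h1 h2] /andP[h3 h4].
by apply/andP; split; nra.
Qed.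

(** This is where rectangularity enters: it allows the kernel to be optimized separately at each
    state-action pair. *)
Lemma rectangular_choice (Q : S -> A -> S -> A -> S -> R) :
  (forall s a, U (Q s a)) -> U (fun s a => Q s a s a).
Proof.
by have [Usa _ ->] := U_rect => UQ s a /=; have := UQ s a; apply.
Qed.

Lemma continuous_action_value g v s a :
  continuous (fun P => action_value g P v s a).
Proof.
apply: continuous_big => [|t _]; first exact: add_continuous.
move=> P; apply: (@continuousM R _ (fun P => P s a t) (cst _) P); last first.
  exact: cst_continuous.
apply: (@continuous_comp (S -> A -> S -> R) (A -> S -> R) R
  (fun P => P s) (fun p => p a t)).
  exact: (@proj_continuous S (fun=> A -> S -> R) s).
apply: (@continuous_comp (A -> S -> R) (S -> R) R (fun p => p a) (fun p => p t)).
  exact: (@proj_continuous A (fun=> S -> R) a).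
exact: (@proj_continuous S (fun=> R) t).
Qed.

(** Compactness gives a minimizer for each pair. The value at [(s, a)] depends on the kernel only
    through [P s a], so gluing the minimizers along the pairs yields one kernel that is worst at all
    of them. *)
Lemma worst_kernel g v : exists2 P, U P & forall Q, U Q ->
  forall s a, action_value g P v s a <= action_value g Q v s a.
Proof.
have H (x : S * A) : exists2 P, U P & forall Q, U Q ->
    action_value g P v x.1 x.2 <= action_value g Q v x.1 x.2.
  have [|P] := compact_EVT_min (f := fun P => action_value g P v x.1 x.2)
    U_nonempty U_compact.
    by apply: continuous_subspaceT; exact: continuous_action_value.
  rewrite inE => UP Pmin; exists P => // Q UQ; apply: Pmin; exact: mem_set.
pose W x := s2val (cid2 (H x)).
exists (fun s a => W (s, a) s a) => [|Q UQ s a].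
  apply: (rectangular_choice (fun s a => W (s, a))) => s a.
  exact: s2valP (cid2 (H (s, a))).
exact: (s2valP' (cid2 (H (s, a)))).
Qed.

Definition worst_value g v s a : R :=
  action_value g (s2val (cid2 (worst_kernel g v))) v s a.

Lemma worst_value_le g P v s a : U P ->
  worst_value g v s a <= action_value g P v s a.
Proof. by move=> UP; apply: (s2valP' (cid2 (worst_kernel g v))). Qed.

Lemma worst_value_attained g v : exists2 P, U P &
  forall s a, worst_value g v s a = action_value g P v s a.
Proof.
exists (s2val (cid2 (worst_kernel g v))) => //.
exact: s2valP (cid2 (worst_kernel g v)).
Qed.

Lemma worst_value_monotone g v u s a : 0 <= g ->
  (forall t, v t <= u t) -> worst_value g v s a <= worst_value g u s a.
Proof.
move=> g0 vu; have [P UP ->] := worst_value_attained g u.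
apply: le_trans (worst_value_le _ _ _ _ _ UP) _.
exact: action_value_monotone UP g0 vu.
Qed.

Lemma worst_value_shift g v k s a :
  worst_value g (fun t => v t + k) s a <= worst_value g v s a + g * k.
Proof.
have [P UP ->] := worst_value_attained g v.
by rewrite -action_value_shift//; exact: worst_value_le.
Qed.

Lemma worst_value_bound g v s a b : 0 <= g <= 1 ->
  (forall s a s', `|r s a s'| <= b) -> (forall t, `|v t| <= b) ->
  `|worst_value g v s a| <= b.
Proof.
move=> g01 rb vb; have [P UP ->] := worst_value_attained g v.
exact: action_value_bound.
Qed.

Definition robust_op g pi v s : R := \sum_a pi s a * worst_value g v s a.

Definition greedy_action g v s : A :=
  [arg max_(a > point) worst_value g v s a]%O.

Definition optimal_op g v s : R := worst_value g v s (greedy_action g v s).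

Lemma worst_value_le_optimal g v s a : worst_value g v s a <= optimal_op g v s.
Proof.
rewrite /optimal_op /greedy_action.
by case: Order.TotalTheory.arg_maxP => // b _; apply.
Qed.

Lemma policy_op_discounting g pi P : stationary pi -> U P -> 0 <= g ->
  discounting g (policy_op g pi P).
Proof.
move=> pis UP g0; split => [v u vu s|v k s _].
  apply: (ler_average _ (pis s)) => a; exact: action_value_monotone.
rewrite -(average_shift _ (pis s)).
by apply: ler_average => // a; rewrite action_value_shift.
Qed.

Lemma robust_op_discounting g pi : stationary pi -> 0 <= g ->
  discounting g (robust_op g pi).
Proof.
move=> pis g0; split => [v u vu s|v k s _].
  apply: (ler_average _ (pis s)) => a; exact: worst_value_monotone.
rewrite -(average_shift _ (pis s)).
by apply: ler_average => // a; exact: worst_value_shift.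
Qed.

Lemma optimal_op_discounting g : 0 <= g -> discounting g (optimal_op g).
Proof.
move=> g0; split => [v u vu s|v k s _].
  apply: le_trans (worst_value_le_optimal _ _ _ _).
  exact: worst_value_monotone.
apply: le_trans (worst_value_shift _ _ _ _ _) _.
by rewrite lerD2r worst_value_le_optimal.
Qed.

(** * Fixed points and robust values *)

Definition reward_bound : R := \sum_(x : S * A * S) `|r x.1.1 x.1.2 x.2|.

Lemma reward_boundP s a s' : `|r s a s'| <= reward_bound.
Proof.
rewrite /reward_bound (bigD1 (s, a, s'))//= lerDl.
by apply: sumr_ge0 => x _; exact: normr_ge0.
Qed.

Lemma reward_bound_ge0 : 0 <= reward_bound.
Proof. by apply: sumr_ge0 => x _; exact: normr_ge0. Qed.

Lemma bounded_fixpoint g F : 0 <= g < 1 -> discounting g F ->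
  (forall v s, (forall t, `|v t| <= reward_bound) -> `|F v s| <= reward_bound) ->
  exists v, (forall s, F v s = v s) /\ (forall s, `|v s| <= reward_bound).
Proof.
move=> /andP[g0 g1] Fd Fb; apply: (discounting_fixpoint _ _ _ Fd g1) => s.
  have : `|F (fun=> - reward_bound) s| <= reward_bound.
    by apply: Fb => t; rewrite normrN ger0_norm ?reward_bound_ge0.
  by rewrite ler_norml => /andP[].
have : `|F (fun=> reward_bound) s| <= reward_bound.
  by apply: Fb => t; rewrite ger0_norm ?reward_bound_ge0.
by rewrite ler_norml => /andP[].
Qed.

Let g01W g : 0 <= g < 1 -> 0 <= g <= 1.
Proof. by move=> /andP[-> /ltW]. Qed.

Lemma robust_fixpoint g pi : stationary pi -> 0 <= g < 1 ->
  exists v, (forall s, robust_op g pi v s = v s) /\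
            (forall s, `|v s| <= reward_bound).
Proof.
move=> pis g01; apply: (bounded_fixpoint _ _ g01) => [|v s vb].
  by apply: robust_op_discounting => //; case/andP: g01.
apply: (average_bound _ (pis s)) => a.
by apply: worst_value_bound => //; [exact: g01W|exact: reward_boundP].
Qed.

Lemma policy_fixpoint g pi P : stationary pi -> U P -> 0 <= g < 1 ->
  exists v, forall s, policy_op g pi P v s = v s.
Proof.
move=> pis UP g01.
have [||v [vE _]] := bounded_fixpoint _ (policy_op g pi P) g01; last by exists v.
  by apply: policy_op_discounting => //; case/andP: g01.
move=> v s vb; apply: (average_bound _ (pis s)) => a.
by apply: action_value_bound => //; [exact: g01W|exact: reward_boundP].
Qed.

Lemma optimal_fixpoint g : 0 <= g < 1 ->
  exists v, forall s, optimal_op g v s = v s.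
Proof.
move=> g01.
have [||v [vE _]] := bounded_fixpoint _ (optimal_op g) g01; last by exists v.
  by apply: optimal_op_discounting => //; case/andP: g01.
move=> v s vb.
by apply: worst_value_bound => //; [exact: g01W|exact: reward_boundP].
Qed.

Definition robust_value g pi : S -> R :=
  xget (fun=> 0) [set v | (forall s, robust_op g pi v s = v s) /\
                          (forall s, `|v s| <= reward_bound)].

Lemma robust_valueP g pi : stationary pi -> 0 <= g < 1 ->
  (forall s, robust_op g pi (robust_value g pi) s = robust_value g pi s) /\
  (forall s, `|robust_value g pi s| <= reward_bound).
Proof.
move=> pis g01; rewrite /robust_value; case: xgetP => [v _ //|].
by move=> H; have [v /H] := robust_fixpoint _ _ pis g01.
Qed.

Lemma robust_value_sub g pi P s : stationary pi -> 0 <= g < 1 -> U P ->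
  robust_value g pi s <= policy_op g pi P (robust_value g pi) s.
Proof.
move=> pis g01 UP; rewrite -[leLHS](robust_valueP _ _ pis g01).1.
by apply: (ler_average _ (pis s)) => a; exact: worst_value_le.
Qed.

Lemma robust_value_le g pi P v : stationary pi -> 0 <= g < 1 -> U P ->
  (forall s, policy_op g pi P v s = v s) -> forall s, robust_value g pi s <= v s.
Proof.
move=> pis g01 UP vE; case/andP: (g01) => g0 g1.
apply: (discounting_comparison _ _ _ _ (policy_op_discounting g pi P pis UP g0) g1).
- by move=> s; exact: robust_value_sub.
- by move=> s; rewrite vE.
Qed.

(** The kernel is the one that is worst against the robust value itself. With [robust_value_le],
    this makes the robust value a minimum over [U], attained at all states by the same kernel. *)
Lemma robust_value_attained g pi : stationary pi -> 0 <= g < 1 ->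
  exists2 P, U P & forall s,
    policy_op g pi P (robust_value g pi) s = robust_value g pi s.
Proof.
move=> pis g01; have [P UP PE] := worst_value_attained g (robust_value g pi).
exists P => // s; rewrite -[RHS](robust_valueP _ _ pis g01).1.
by apply: eq_bigr => a _; rewrite PE.
Qed.

(** * Deterministic policies *)

Definition deterministic (d : S -> A) : S -> A -> R := fun s a => (a == d s)%:R.

Lemma deterministic_sum d s (f : A -> R) :
  \sum_a deterministic d s a * f a = f (d s).
Proof.
rewrite (bigD1 (d s))//= /deterministic eqxx mul1r big1 ?addr0// => a /negPf->.
by rewrite mul0r.
Qed.

Lemma deterministic_stationary d : stationary_deterministic (deterministic d).
Proof.
split=> s; last by exists (d s); rewrite /deterministic eqxx.
split=> [a|]; first exact: ler0n.
rewrite -[RHS](deterministic_sum d s (fun=> 1)).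
by apply: eq_bigr => a _; rewrite mulr1.
Qed.

(** Let [V] be the fixed point of [optimal_op]. Every robust value is a subsolution for
    [optimal_op], hence at most [V]; and [V] solves the robust equation of its greedy policy, hence
    is at most that policy's robust value. The type [{ffun S -> A}] is finite, which later allows a
    maximum over policies. *)
Lemma deterministic_optimal g : 0 <= g < 1 ->
  exists d : {ffun S -> A}, forall pi, stationary pi ->
    forall s, robust_value g pi s <= robust_value g (deterministic d) s.
Proof.
move=> g01; have [V VE] := optimal_fixpoint g g01; case/andP: (g01) => g0 g1.
pose d := [ffun s => greedy_action g V s]; exists d => pi pis s.
have ds := (deterministic_stationary d).1.
have [dE _] := robust_valueP _ _ ds g01.
apply: (@le_trans _ _ (V s)).
  apply: (discounting_comparison _ _ _ _ (optimal_op_discounting g g0) g1) => t.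
    rewrite -[leLHS](robust_valueP _ _ pis g01).1.
    rewrite -(average_cst _ (pis t) (optimal_op _ _ _)).
    by apply: (ler_average _ (pis t)) => a; exact: worst_value_le_optimal.
  by rewrite VE.
apply: (discounting_comparison _ _ _ _ (robust_op_discounting g _ ds g0) g1) => t.
  by rewrite /robust_op deterministic_sum ffunE -[leLHS]VE.
by rewrite dE.
Qed.

(** * Comparison of two discount factors *)

Definition transition pi P v s : R := \sum_a pi s a * \sum_s' P s a s' * v s'.

Definition expected_reward pi P s : R :=
  \sum_a pi s a * \sum_s' P s a s' * r s a s'.

(** Neither [expected_reward] nor [transition] involves [g], so the equations of one kernel at two
    discount factors can be combined. *)
Lemma policy_opE g pi P v s : policy_op g pi P v s =
  (1 - g) * expected_reward pi P s + g * transition pi P v s.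
Proof.
rewrite /policy_op -average_lin; apply: eq_bigr => a _.
by rewrite -average_lin.
Qed.

Lemma transition_lin pi P a b v u s :
  transition pi P (fun t => a * v t + b * u t) s =
  a * transition pi P v s + b * transition pi P u s.
Proof.
by rewrite /transition -average_lin; apply: eq_bigr => c _; rewrite average_lin.
Qed.

Lemma transition_shift pi P k v s : stationary pi -> U P ->
  transition pi P (fun t => v t + k) s = transition pi P v s + k.
Proof.
move=> pis UP; rewrite /transition -(average_shift _ (pis s)).
by apply: eq_bigr => c _; rewrite (average_shift _ (U_simplex _ UP s c)).
Qed.

Lemma transition_monotone pi P v u s : stationary pi -> U P ->
  (forall t, v t <= u t) -> transition pi P v s <= transition pi P u s.
Proof.
move=> pis UP vu; apply: (ler_average _ (pis s)) => a.
exact: (ler_average _ (U_simplex _ UP s a)).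
Qed.

Lemma transition_bound pi P v s b : stationary pi -> U P ->
  (forall t, `|v t| <= b) -> `|transition pi P v s| <= b.
Proof.
move=> pis UP vb; apply: (average_bound _ (pis s)) => a.
exact: (average_bound _ (U_simplex _ UP s a)).
Qed.

Lemma expected_reward_bound pi P s : stationary pi -> U P ->
  `|expected_reward pi P s| <= reward_bound.
Proof.
move=> pis UP; apply: (average_bound _ (pis s)) => a.
apply: (average_bound _ (U_simplex _ UP s a)) => t; exact: reward_boundP.
Qed.

(* With [al := (1 - g') / (1 - g)], the convex combination
   [al * v_g + (1 - al) * (w - e)] is a subsolution of the Bellman equation at
   discount [g'], for every kernel in [U]. *)
Lemma robust_value_lower_bound g g' pi w e : stationary pi ->
  0 <= g -> g < g' < 1 ->
  (forall P, U P -> forall s, w s <= transition pi P w s) ->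
  (forall s, `|robust_value g pi s - w s| <= e) ->
  forall s, w s - e <= robust_value g' pi s.
Proof.
move=> pis g0 /andP[gg' g'1] wT vw s.
have g1 : g < 1 by exact: lt_trans g'1.
have g'0 : 0 <= g' by exact: le_trans (ltW gg').
(* With [P] worst at [g'], the robust value at [g'] is a fixed point of a single linear operator,
   against which the subsolution is compared. *)
have [|P UP PE] := robust_value_attained g' pi pis; first by rewrite g'0.
set v := robust_value g pi in vw *.
pose al := (1 - g') / (1 - g).
have alE : al * (1 - g) = 1 - g' by rewrite divfK// subr_eq0 gt_eqF.
have al0 : 0 <= al by rewrite divr_ge0// subr_ge0 ltW.
have al1 : al <= 1 by rewrite ler_pdivrMr ?subr_gt0// mul1r lerD2l lerN2 ltW.
have {}vw t : w t - e <= v t <= w t + e.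
  by have := vw t; rewrite ler_distl.
pose x t := al * v t + (1 - al) * (w t - e).
apply: (@le_trans _ _ (x s)).
  by rewrite /x; have /andP[h _] := vw s; nra.
apply: (discounting_comparison _ _ _ _
  (policy_op_discounting g' pi P pis UP g'0) g'1) => t; last by rewrite PE.
rewrite policy_opE /x transition_lin transition_shift//.
have : v t <= policy_op g pi P v t.
  by apply: robust_value_sub => //; rewrite g0.
rewrite policy_opE.
have h2 := wT P UP t.
have h3 : transition pi P w t - e <= transition pi P v t.
  rewrite -transition_shift//; apply: transition_monotone => // i.
  by case/andP: (vw i).
set Tv := transition pi P v t in h3 *; set Tw := transition pi P w t in h2 h3 *.
set c := expected_reward _ _ _ => h1.
have k1 : al * v t <= (1 - g') * c + al * g * Tv by rewrite -alE; nra.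
have k2 : (1 - al) * (w t - e) <= (1 - al) * (Tw - e) by nra.
(* The bound to reach exceeds the sum of those in [k1] and [k2] by [al * (g' - g) * Tv - (1 - g') *
   (1 - al) * (Tw - e)]. The two coefficients agree and [Tw - e <= Tv], so this is nonnegative. *)
have k3 : al * (g' - g) = (1 - g') * (1 - al).
  by lra.
have k4 : (1 - g') * (1 - al) * (Tw - e) <= al * (g' - g) * Tv.
  by rewrite k3 ler_wpM2l// mulr_ge0 ?subr_ge0// ltW.
lra.
Qed.

(** * Cluster points and convergence as the discount factor tends to 1 *)

Definition frequently_near1 (Q : R -> Prop) : Prop :=
  forall d, d < 1 -> exists2 g, d < g < 1 & Q g.

(** The values lie in a box of [S -> R], compact by Tychonoff, so they cluster along a sequence of
    discount factors that satisfy [Q] and tend to 1. The predicate [Q] is used below to force a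
    second cluster point away from a first one. *)
Lemma robust_value_cluster pi (Q : R -> Prop) : stationary pi ->
  frequently_near1 Q -> exists w, forall e, 0 < e ->
    frequently_near1 (fun g => Q g /\ forall s, `|robust_value g pi s - w s| < e).
Proof.
move=> pis Qrec.
have gn n : exists g, [/\ 1 - n.+1%:R^-1 < g, 0 <= g < 1 & Q g].
  have [|g /andP[g1 g2] Qg] := Qrec (1 - n.+1%:R^-1).
    by rewrite ltrBlDr ltrDl invr_gt0.
  exists g; split => //; rewrite g2 andbT (le_trans _ (ltW g1))//.
  by rewrite subr_ge0 invf_le1// ler1n.
pose g n := proj1_sig (cid (gn n)).
have gP n : [/\ 1 - n.+1%:R^-1 < g n, 0 <= g n < 1 & Q (g n)].
  exact: proj2_sig (cid (gn n)).
pose u n : S -> R := robust_value (g n) pi.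
pose K : set (S -> R) := [set f | forall s, `[- reward_bound, reward_bound]%classic (f s)].
have cK : @compact (S -> R) K.
  exact: (@tychonoff S (fun=> R) _ (fun=> @segment_compact R _ _)).
have uK : (u @ \oo) K.
  exists 0 => // n _ s /=; rewrite in_itv/= -ler_norml.
  by have [_ gn01 _] := gP n; exact: (robust_valueP _ _ pis gn01).2.
have [w [_ wcl]] := cK _ _ uK.
exists w => e e0 d d1.
have d0 : 0 < 1 - d by rewrite subr_gt0.
have [N _ HN] := near_infty_natSinv_lt (PosNum d0).
have nbw : nbhs w [set f : S -> R | forall s, `|f s - w s| < e].
  apply: (@filter_forall _ _ (fun s => [set f : S -> R | `|f s - w s| < e])
    (nbhs w) _) => s.
  have := @proj_continuous S (fun=> R) s w [set y | `|y - w s| < e].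
  apply; exists e => //= y; by rewrite /ball_/= distrC.
have [|f [[n /= Nn <-] fw]] := wcl (u @` [set n | (N <= n)%N]) _ _ nbw.
  by exists N => // n Nn; exists n.
have [g1 /andP[g2 g3] Qg] := gP n.
exists (g n); last by split.
rewrite g3 andbT; have h : n.+1%:R^-1 < 1 - d := HN n Nn.
apply: le_lt_trans g1; rewrite lerBrDr addrC -lerBrDr; exact: ltW.
Qed.

Lemma cluster_subharmonic pi w : stationary pi ->
  (forall e, 0 < e ->
    frequently_near1 (fun g => forall s, `|robust_value g pi s - w s| < e)) ->
  forall P, U P -> forall s, w s <= transition pi P w s.
Proof.
move=> pis wcl P UP s; apply/ler_addgt0Pr => e e0.
pose b := reward_bound; have b0 : 0 <= b := reward_bound_ge0.
(* Replacing [v_g] by [w] costs [k] on each side. Since [1 - g < k], dropping the reward term and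
   the factor [g] costs at most [k * b] each. *)
pose k := e / (2 + 2 * b).
have k0 : 0 < k by rewrite divr_gt0//; lra.
have ke : k * (2 + 2 * b) = e by rewrite divfK// gt_eqF//; lra.
have [|g /andP[g1 g2] vw] := wcl k k0 (Num.max 0 (1 - k)).
  by rewrite gt_max ltr01/=; lra.
move: g1; rewrite gt_max => /andP[g0 gk].
have g01 : 0 <= g < 1 by rewrite ltW.
have := robust_value_sub g pi P s pis g01 UP; rewrite policy_opE.
have := expected_reward_bound pi P s pis UP.
have := transition_bound pi P _ s b pis UP (robust_valueP _ _ pis g01).2.
have : transition pi P (robust_value g pi) s <= transition pi P w s + k.
  rewrite -transition_shift//; apply: transition_monotone => // t.
  by have := vw t; rewrite ltr_distl => /andP[_ /ltW].
have := vw s; rewrite ltr_distl => /andP[h0 _] h1.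
rewrite !ler_norml => /andP[h2 h3] /andP[h4 h5] h6.
rewrite -/b in h4 h5; nra.
Qed.

Lemma robust_value_cvg pi : stationary pi -> exists w, forall e, 0 < e ->
  exists2 d : R, 0 < d < 1 & forall g, d < g < 1 ->
    forall s, `|robust_value g pi s - w s| <= e.
Proof.
move=> pis.
have lower w : (forall e, 0 < e ->
      frequently_near1 (fun g => forall s, `|robust_value g pi s - w s| < e)) ->
    forall e, 0 < e -> exists2 d, 0 < d < 1 & forall g, d < g < 1 ->
      forall s, w s - e <= robust_value g pi s.
  (* One discount factor [d] at which the value is [e]-close to [w] controls all larger ones. *)
  move=> wcl e e0; have [d /andP[d0 d1] vw] := wcl e e0 0 ltr01.
  exists d => [|g dg s]; first by rewrite d0.
  apply: (robust_value_lower_bound d g pi w e) => // [|P UP t|t].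
  - exact: ltW.
  - exact: (cluster_subharmonic _ _ pis wcl).
  - exact: ltW.
have [|w wcl] := robust_value_cluster pi (fun=> True) pis.
  by move=> d d1; exists ((d + 1) / 2) => //; apply/andP; split; lra.
have {}wcl e : 0 < e ->
    frequently_near1 (fun g => forall s, `|robust_value g pi s - w s| < e).
  by move=> e0 d d1; have [g dg [_ ?]] := wcl e e0 d d1; exists g.
exists w => e e0.
have [d1 /andP[d10 d11] low] := lower w wcl e e0.
have [[d2 d21 up]|noup] := pselect (exists2 d, d < 1 & forall g, d < g < 1 ->
    forall s, robust_value g pi s <= w s + e).
  exists (Num.max d1 d2) => [|g]; first by rewrite lt_max gt_max d10 d11 d21.
  rewrite gt_max => /andP[/andP[h1 h2] h3] s.
  by rewrite ler_distl low ?h1// up// h2.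
(* Otherwise values exceed [w + e] at some state for discount factors arbitrarily close to 1, and a
   second cluster point [w'] arises along these. *)
have [|w' w'cl] := robust_value_cluster pi
    (fun g => exists s, w s + e < robust_value g pi s) pis.
  move=> d dlt1; apply: contrapT => nog; apply: noup; exists d => // g dg s.
  by rewrite leNgt; apply/negP => h; apply: nog; exists g => //; exists s.
(* At the state [s] found below, [w + e < v_g' < w' + e / 4] and [w' - e / 4 <= v_g < w + e / 4],
   whence [e < 3 * e / 4]. *)
have e4 : 0 < e / 4 by rewrite divr_gt0.
have [|d' /andP[d'0 d'1] low'] := lower w' _ _ e4.
  by move=> k k0 d dlt1; have [g dg [_ ?]] := w'cl k k0 d dlt1; exists g.
have [g dg vw] := wcl _ e4 d' d'1.
have [g' dg' [[s vws] vw']] := w'cl _ e4 d' d'1.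
have := low' g dg s; have := vw s; have := vw' s.
rewrite !ltr_distl => /andP[h1 h2] /andP[h3 h4] h5; lra.
Qed.

End bellman.

(** * Integration of functions of a finite-valued variable *)

Section finite_range.
Context {d} {T : measurableType d} {R : realType} (mu : probability T R).
Context {Y : finType} (Z : T -> Y).
Hypothesis mZ : forall y, measurable [set w | Z w = y].

Let finite_rangeE (f : Y -> R) w :
  f (Z w) = \sum_y f y * \1_[set w | Z w = y] w.
Proof.
rewrite (bigD1 (Z w))//= indicE mem_set// mulr1 big1 ?addr0// => y yZ.
rewrite indicE memNset ?mulr0//= => /esym/eqP; exact/negP.
Qed.

Lemma measurable_finite_range (f : Y -> R) : measurable_fun setT (f \o Z).
Proof.
apply: (eq_measurable_fun (fun w => \sum_y f y * \1_[set w | Z w = y] w)).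
  by move=> w _; rewrite -finite_rangeE.
apply: measurable_sum => y; apply: measurable_funM => //.
Qed.

Lemma integrable_finite_range (f : Y -> R) :
  mu.-integrable setT (EFin \o (f \o Z)).
Proof.
apply: measurable_bounded_integrable => //.
- exact: le_lt_trans (probability_le1 mu measurableT) (ltry 1).
- exact: measurable_finite_range.
- exists (\sum_y `|f y|); split; first exact: num_real.
  move=> M hM w _ /=; apply: le_trans (ltW hM).
  by rewrite (bigD1 (Z w))//= lerDl sumr_ge0.
Qed.

Lemma integral_finite_range (f : Y -> R) :
  (\int[mu]_w (f (Z w))%:E = \sum_y (f y)%:E * mu [set w | Z w = y])%E.
Proof.
under eq_integral do rewrite finite_rangeE -sumEFin.
rewrite integral_sum// => [|y]; last first.
  under eq_fun do rewrite EFinM.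
  by apply: integrableZl => //; exact: integrable_indic.
apply: eq_bigr => y _; under eq_integral do rewrite EFinM.
rewrite integralZl//; last exact: integrable_indic.
by rewrite integral_indic// setIT.
Qed.

End finite_range.

(** * Markov property of the trajectory law *)

Section trajectory_law_facts.
Context {R : realType} {S A : finPointedType}.
Variables (p0 : S -> R) (pi : S -> A -> R) (P : S -> A -> S -> R).
Hypothesis p0_simplex : simplex p0.
Hypothesis pi_simplex : forall s, simplex (pi s).
Hypothesis P_simplex : forall s a, simplex (P s a).

Local Notation mu := (trajectory_law p0 pi P).
Local Notation T := (trajectory S A).

Let cylE n h : mu (cylinder n h) = (path_prob p0 pi P n h)%:E.
Proof. exact: trajectory_law_cylinder. Qed.

Lemma measurable_cylinder n h : measurable (cylinder n h : set T).
Proof. by apply: sub_sigma_algebra; exists n, h. Qed.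

(** Turns a finite history into the sequence that [cylinder] expects; [cylinder n] reads it only up
    to time [n], where [inord] is exact. *)
Let path n (g : {ffun 'I_n.+1 -> S * A}) (t : nat) : S * A := g (inord t).

Let coordE n x : [set w : T | w n = x] =
  \bigcup_(g in [set g : {ffun 'I_n.+1 -> S * A} | g ord_max = x])
    cylinder n (path n g).
Proof.
apply/seteqP; split=> [w /= wn|w [g /= <-]]; last first.
  move=> /(_ n (leqnn n)) ->; rewrite /path; congr (g _).
  by apply: val_inj; rewrite /= inordK.
exists [ffun i : 'I_n.+1 => w i] => /=; first by rewrite ffunE.
by move=> t tn; rewrite /path ffunE inordK.
Qed.

Lemma measurable_coord n x : measurable [set w : T | w n = x].
Proof.
rewrite coordE; apply: fin_bigcup_measurable; first exact: finite_finset.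
by move=> g _; exact: measurable_cylinder.
Qed.

Lemma measurable_coord2 n (x : (S * A) * (S * A)) :
  measurable [set w : T | (w n, w n.+1) = x].
Proof.
rewrite (_ : [set w | _] = [set w : T | w n = x.1] `&` [set w | w n.+1 = x.2]).
  by apply: measurableI; exact: measurable_coord.
by case: x => x y; apply/seteqP; split => w /= [-> ->].
Qed.

Let path_trivIset n (D : set {ffun 'I_n.+1 -> S * A}) :
  trivIset D (fun g => cylinder n (path n g) : set T).
Proof.
apply/trivIsetP => f g _ _ /eqP fg; apply/seteqP; split=> // w [wf wg].
apply: fg; apply/ffunP => i; have := wf i (ltn_ord i).
by rewrite (wg i (ltn_ord i)) /path inord_val.
Qed.

Lemma initial_law x : mu [set w : T | w 0 = x] = (p0 x.1 * pi x.1 x.2)%:E.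
Proof.
rewrite (_ : [set w : T | _] = cylinder 0 (fun=> x)).
  by rewrite cylE /path_prob big_ord0 mulr1.
apply/seteqP; split => [w /= <- t|w /(_ 0)]; last exact.
by rewrite leqn0 => /eqP ->.
Qed.

(** The Markov property, as a product so that null events need no separate case. The event [w n = x]
    is split into cylinders, and prolonging a history by [y] multiplies its [path_prob] by one
    factor. *)
Lemma transition_law n x y :
  mu [set w : T | (w n, w n.+1) = (x, y)] =
  (mu [set w : T | w n = x] * (P x.1 x.2 y.1 * pi y.1 y.2)%:E)%E.
Proof.
pose D := [set g : {ffun 'I_n.+1 -> S * A} | g ord_max = x].
rewrite (_ : [set w | _] = [set w : T | w n = x] `&` [set w | w n.+1 = y]); last first.
  by apply/seteqP; split => w /= [-> ->].
rewrite [in LHS]coordE setI_bigcupl [in RHS]coordE.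
have mcyl g : D g -> measurable (cylinder n (path n g) : set T).
  by move=> _; exact: measurable_cylinder.
rewrite (measure_fin_bigcup _ finite_finset (path_trivIset n D) mcyl).
rewrite (measure_fin_bigcup _ finite_finset); last 2 first.
- by apply: trivIset_setIr; exact: path_trivIset.
- by move=> g /mcyl mg; apply: measurableI mg _; exact: measurable_coord.
rewrite ge0_mule_fsuml//.
apply: eq_fsbigr => g; rewrite inE => gx.
pose h t := if (t <= n)%N then path n g t else y.
rewrite (_ : _ `&` _ = cylinder n.+1 h); last first.
  apply/seteqP; split => [w [wg /= wy] t|w wh].
    by rewrite /h leq_eqVlt => /predU1P[->|]; rewrite ?ltnn// ltnS => tn; rewrite tn wg.
  split => [t tn|/=]; first by rewrite wh 1?ltnW// /h tn.
  by rewrite wh// /h ltnn.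
transitivity (path_prob p0 pi P n.+1 h)%:E; first exact: cylE.
transitivity ((path_prob p0 pi P n (path n g))%:E *
  (P x.1 x.2 y.1 * pi y.1 y.2)%:E)%E; last by congr (_ * _)%E; rewrite -cylE.
rewrite -EFinM; congr EFin.
rewrite /path_prob big_ord_recr /= mulrA; congr (_ * _ * _).
- apply: eq_bigr => i _.
  by rewrite /h (ltnW (ltn_ord i)) ltn_ord.
- have -> : h n = x.
    rewrite /h leqnn -gx /path; congr (g _); apply: val_inj; by rewrite /= inordK.
  by rewrite /h ltnn.
Qed.

End trajectory_law_facts.

Lemma geometric_dominated_series {R : realType} (u : R ^nat) (b g : R) :
  0 <= g < 1 -> (forall n, `|u n| <= b * g ^+ n) -> cvgn (series u).
Proof.
move=> /andP[g0 g1] ub; apply: normed_cvg.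
apply: (@series_le_cvg _ (fun n => `|u n|) (geometric b g)) => //.
  by move=> n; apply: le_trans (ub n).
by apply: is_cvg_geometric_series; rewrite ger0_norm.
Qed.

(** * The expected return computed from a Bellman fixed point, by a martingale *)

Section expected_discounted_return.
Context {R : realType} {S A : finPointedType}.
Variables (p0 : S -> R) (pi : S -> A -> R) (P : S -> A -> S -> R).
Hypothesis p0_simplex : simplex p0.
Hypothesis pi_simplex : forall s, simplex (pi s).
Hypothesis P_simplex : forall s a, simplex (P s a).
Variables (r : S -> A -> S -> R) (g : R) (v : S -> R).
Hypothesis g01 : 0 <= g < 1.
Hypothesis v_fix : forall s, policy_op r g pi P v s = v s.

Local Notation mu := (trajectory_law p0 pi P).
Local Notation T := (trajectory S A).

Let q (x : S * A) := action_value r g P v x.1 x.2.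

(** The step of [forecast] without its factor [g ^+ n]; dividing by [1 - g] undoes the normalization
    of [q]. *)
Let increment (x : (S * A) * (S * A)) : R :=
  r x.1.1 x.1.2 x.2.1 + (g * q x.2 - q x.1) / (1 - g).

(* Partial discounted sum, with the tail replaced by its conditional
   expectation. *)
Let forecast (n : nat) (w : T) : R :=
  series (fun t => g ^+ t * r (w t).1 (w t).2 (w t.+1).1) n +
  g ^+ n / (1 - g) * q (w n).

Let g1 : 1 - g != 0.
Proof. by rewrite subr_eq0 gt_eqF//; case/andP: g01. Qed.

Let forecastS n w :
  forecast n.+1 w = forecast n w + g ^+ n * increment (w n, w n.+1).
Proof. by rewrite /forecast seriesSr /increment /= exprS; field. Qed.

(** Averaging [q] over the next action gives [v], because [v] is a fixed point; averaging over the
    next state then gives back [q x], by definition of [action_value]. *)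
Let increment_mean x : \sum_y (P x.1 x.2 y.1 * pi y.1 y.2) * increment (x, y) = 0.
Proof.
rewrite -(pair_bigA _ (fun s a => P x.1 x.2 s * pi s a * increment (x, (s, a))))/=.
transitivity (\sum_s P x.1 x.2 s *
    ((1 - g)^-1 * ((1 - g) * r x.1 x.2 s + g * v s) + (- (1 - g)^-1) * q x)).
  apply: eq_bigr => s _; under eq_bigr do rewrite -mulrA; rewrite -mulr_sumr.
  congr (_ * _); transitivity (\sum_a pi s a * (g / (1 - g) * q (s, a) +
      1 * (r x.1 x.2 s - q x / (1 - g)))).
    by apply: eq_bigr => a _; rewrite /increment/=; field.
  rewrite average_lin average_cst//.
  rewrite (_ : \sum_a pi s a * q (s, a) = v s); last exact: v_fix.
  by field.
by rewrite average_lin average_cst// mulNr subrr.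
Qed.

Let integrable_increment n :
  mu.-integrable setT (EFin \o (fun w : T => increment (w n, w n.+1))).
Proof.
exact: (integrable_finite_range mu (fun w : T => (w n, w n.+1))
  (measurable_coord2 n) increment).
Qed.

Let integral_increment n : (\int[mu]_w (increment (w n, w n.+1))%:E = 0)%E.
Proof.
rewrite (integral_finite_range mu (fun w : T => (w n, w n.+1)) (measurable_coord2 n) increment).
transitivity (\sum_x \sum_y (increment (x, y))%:E *
    mu [set w : T | (w n, w n.+1) = (x, y)])%E.
  by rewrite pair_bigA; apply: eq_bigr => -[x y].
rewrite big1// => x _.
under eq_bigr do rewrite transition_law//.
have /fineK <- : mu [set w : T | w n = x] \is a fin_num.
  by apply: fin_num_measure; exact: measurable_coord.
under eq_bigr do rewrite -!EFinM mulrCA.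
rewrite sumEFin -mulr_sumr; under eq_bigr do rewrite mulrC.
by rewrite increment_mean mulr0.
Qed.

Let integral_initial f :
  (\int[mu]_w (f (w 0%N))%:E = (\sum_s p0 s * \sum_a pi s a * f (s, a))%:E)%E.
Proof.
rewrite (integral_finite_range mu (fun w : T => w 0%N) (measurable_coord 0) f).
under eq_bigr do rewrite initial_law// -EFinM.
rewrite sumEFin; congr EFin.
transitivity (\sum_s \sum_a f (s, a) * (p0 s * pi s a)).
  by rewrite pair_bigA; apply: eq_bigr => -[s a].
by apply: eq_bigr => s _; rewrite mulr_sumr; apply: eq_bigr => a _; rewrite mulrC mulrA.
Qed.

(** The increments have mean zero, so the expectation keeps its value at time 0, where [forecast] is
    [q (w 0) / (1 - g)]. *)
Let integral_forecast n : mu.-integrable setT (EFin \o forecast n) /\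
  (\int[mu]_w (forecast n w)%:E = ((\sum_s p0 s * v s) / (1 - g))%:E)%E.
Proof.
elim: n => [|n [IH1 IH2]].
  have forecast0 w : forecast 0 w = q (w 0%N) / (1 - g).
    by rewrite /forecast /series/= big_geq// expr0; field.
  split; last first.
    under eq_integral do rewrite forecast0.
    rewrite (integral_initial (fun x => q x / (1 - g))); congr EFin.
    rewrite mulr_suml; apply: eq_bigr => s _; rewrite -mulrA -v_fix mulr_suml.
    by congr (_ * _); apply: eq_bigr => a _; rewrite mulrA.
  rewrite (_ : EFin \o _ = EFin \o (fun w : T => q (w 0%N) / (1 - g))).
    exact: (integrable_finite_range mu (fun w : T => w 0%N) (measurable_coord 0)
      (fun x => q x / (1 - g))).
  by apply/funext => w /=; rewrite forecast0.
have iinc : mu.-integrable setT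
    (fun w : T => (g ^+ n)%:E * (increment (w n, w n.+1))%:E)%E.
  by apply: integrableZl => //; exact: integrable_increment.
split.
  rewrite (_ : EFin \o _ = (EFin \o forecast n) \+
    (fun w : T => (g ^+ n)%:E * (increment (w n, w n.+1))%:E)%E).
    exact: integrableD.
  by apply/funext => w /=; rewrite forecastS EFinD EFinM.
under eq_integral do rewrite forecastS EFinD EFinM.
rewrite integralD// IH2 integralZl//; last exact: integrable_increment.
by rewrite integral_increment mule0 adde0.
Qed.

Let reward_term (w : T) (t : nat) : R :=
  g ^+ t * r (w t).1 (w t).2 (w t.+1).1.

Let b := reward_bound r.
Let c := \sum_x `|q x|.

Let q_bound x : `|q x| <= c.
Proof. by rewrite /c (bigD1 x)//= lerDl; exact: sumr_ge0. Qed.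

Let c0 : 0 <= c. Proof. exact: sumr_ge0. Qed.

Let reward_term_bound w t : `|reward_term w t| <= b * g ^+ t.
Proof.
case/andP: g01 => g0 _; rewrite normrM ger0_norm ?exprn_ge0// mulrC.
by rewrite ler_wpM2r ?exprn_ge0// reward_boundP.
Qed.

Let cvg_forecast w : forecast ^~ w @ \oo --> discounted_sum r g w.
Proof.
rewrite -[discounted_sum r g w]addr0; apply: cvgD.
  exact: (geometric_dominated_series (reward_term w) b g g01).
apply: cvg_series_cvg_0.
apply: (geometric_dominated_series _ (c / (1 - g)) g g01) => n.
have h : 0 <= g ^+ n / (1 - g).
  by case/andP: g01 => g0 g1'; rewrite divr_ge0 ?exprn_ge0// subr_ge0 ltW.
rewrite normrM ger0_norm// (_ : c / _ * _ = g ^+ n / (1 - g) * c); last by field.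
exact: ler_wpM2l.
Qed.

Let forecast_bound n w : `|forecast n w| <= (b + c) / (1 - g).
Proof.
case/andP: g01 => g0 g1'; have d0 : 0 < 1 - g by rewrite subr_gt0.
rewrite mulrDl; apply: le_trans (ler_normD _ _) _; apply: lerD.
  (* The bound keeps the term [- g ^+ n] so that the induction closes. *)
  apply: (@le_trans _ _ (b * (1 - g ^+ n) / (1 - g))).
    elim: n => [|n IH].
      by rewrite /series/= big_geq// normr0 expr0 subrr mulr0 mul0r.
    rewrite seriesSr; apply: le_trans (ler_normD _ _) _.
    rewrite (_ : b * _ / _ = b * (1 - g ^+ n) / (1 - g) + b * g ^+ n).
      exact: lerD (reward_term_bound w n).
    by rewrite exprS; field.
  apply: ler_wpM2r; first by rewrite invr_ge0 ltW.
  by rewrite ler_piMr ?reward_bound_ge0// lerBlDr lerDl exprn_ge0.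
rewrite normrM (mulrC c); have gn0 := exprn_ge0 n g0.
rewrite (ger0_norm (divr_ge0 gn0 (ltW d0))).
apply: ler_pM => //; first exact: divr_ge0 gn0 (ltW d0).
by rewrite ler_piMl ?invr_ge0 ?(ltW d0)// exprn_ile1// ltW.
Qed.

(** The forecasts are uniformly bounded and converge to the discounted sum, so dominated convergence
    carries their constant expectation to the limit. *)
Lemma discounted_returnE :
  (1 - g) * discounted_return p0 pi P r g = \sum_s p0 s * v s.
Proof.
have mf n : measurable_fun setT (EFin \o forecast n).
  exact: measurable_int (integral_forecast n).1.
have D0 : 0 <= (b + c) / (1 - g).
  exact: le_trans (forecast_bound 0 point).
have [||||_ _ H] := @dominated_convergence _ _ _ mu setT measurableT
    (fun n => EFin \o forecast n) (EFin \o discounted_sum r g)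
    (cst ((b + c) / (1 - g))%:E) mf.
- apply/measurable_EFinP; apply: (measurable_fun_cvg (h := forecast)) => [m|w _].
    exact/measurable_EFinP.
  exact: cvg_forecast.
- by apply: aeW => w _ /=; apply: cvg_EFin; [exact: nearW|exact: cvg_forecast].
- exact: finite_measure_integrable_cst.
- by apply: aeW => w n _ /=; rewrite lee_fin forecast_bound.
rewrite /discounted_return unlock.
have -> : (\int[mu]_w (discounted_sum r g w)%:E =
    ((\sum_s p0 s * v s) / (1 - g))%:E)%E.
  apply: cvg_unique H _ => //; apply: cvg_near_cst; apply: nearW => n.
  exact: (integral_forecast n).2.
by rewrite /=; field.
Qed.

End expected_discounted_return.

(** * Selection of a policy with the best limit value *)

Theorem theorem4p5 (R : realType) (S A : finPointedType) (M : rmdp R S A)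
    (hrect : sa_rectangular (uncertainty M)) :
  exists2 pi : S -> A -> R, stationary_deterministic pi &
    forall eps : R, 0 < eps ->
    exists2 gamma_eps : R, 0 < gamma_eps < 1 &
      forall gamma : R, gamma_eps < gamma < 1 ->
      exists2 worst : (S -> A -> R) -> R,
        (forall pi' : S -> A -> R, stationary pi' ->
          is_min [set (1 - gamma) * rmdp_return M gamma pi' P
                   | P in uncertainty M] (worst pi')) &
        worst pi >= sup [set worst pi' | pi' in stationary] - eps.
Proof.
have Us := @uncertainty_simplex _ _ _ M.
have Un := @uncertainty_nonempty _ _ _ M.
have Uc := @uncertainty_compact _ _ _ M.
have p0s := init_simplex M; set p0 := init_distr M in p0s.
pose value g pi := robust_value (reward M) Un Uc hrect g pi.
have det_stat (d : {ffun S -> A}) : stationary (deterministic d : S -> A -> R).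
  exact: (deterministic_stationary d).1.
have cvg_value (d : {ffun S -> A}) := robust_value_cvg (reward M) Us
  Un Uc hrect _ (det_stat d).
pose w d := sval (cid (cvg_value d)).
have wP (d : {ffun S -> A}) (e : R) : 0 < e -> exists2 delta : R, 0 < delta < 1 &
    forall g : R, delta < g < 1 ->
    `|\sum_s p0 s * value g (deterministic d) s - \sum_s p0 s * w d s| <= e.
  move=> e0; have [delta d01 H] := svalP (cid (cvg_value d)) e e0.
  exists delta => // g dg; rewrite -sumrB; under eq_bigr do rewrite -mulrBr.
  exact: (average_bound _ p0s _ _ (H g dg)).
(* The limits [w d] do not depend on [eps], hence neither does the policy. *)
pose best := [arg max_(d > [ffun=> point]) \sum_s p0 s * w d s]%O.
have bestP d : \sum_s p0 s * w d s <= \sum_s p0 s * w best s.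
  by rewrite /best; case: Order.TotalTheory.arg_maxP => // i _; apply.
exists (deterministic best); first exact: deterministic_stationary.
move=> eps eps0; have e2 : 0 < eps / 2 by rewrite divr_gt0.
pose delta d : R := s2val (cid2 (wP d _ e2)).
(* Beyond [gamma_eps] every deterministic policy is within [eps / 2] of its limit; [2^-1] is only a
   starting value below 1 for the maximum. *)
pose gamma_eps : R := \big[Num.max/2^-1]_d delta d.
have delta_le d : delta d <= gamma_eps by exact: le_bigmax.
exists gamma_eps => [|g /andP[gg g1]].
  apply/andP; split.
    by apply: lt_le_trans (delta_le best); case/andP: (s2valP (cid2 (wP best _ e2))).
  apply: bigmax_lt => [|d _]; first by rewrite invf_lt1// ltr1n.
  by case/andP: (s2valP (cid2 (wP d _ e2))).
have near (d : {ffun S -> A}) : `|\sum_s p0 s * value g (deterministic d) s -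
    \sum_s p0 s * w d s| <= eps / 2.
  apply: (s2valP' (cid2 (wP d _ e2))); rewrite g1 andbT.
  exact: le_lt_trans (delta_le d) gg.
have g01 : 0 <= g < 1.
  rewrite g1 andbT; apply/ltW/(lt_trans _ gg)/(lt_le_trans _ (delta_le best)).
  by case/andP: (s2valP (cid2 (wP best _ e2))).
(* The average over [p0] of the robust values is still a minimum, since one kernel attains them at
   all states. *)
exists (fun pi => \sum_s p0 s * value g pi s) => [pi pis|].
  split=> [|_ [P UP <-]].
    have [P UP PE] := robust_value_attained (reward M) Us
      Un Uc hrect g pi pis g01.
    exists P => //; exact: discounted_returnE p0s pis (Us P UP) _ _ _ g01 PE.
  have [v vE] := policy_fixpoint (reward M) Us g pi P pis UP g01.
  rewrite (discounted_returnE _ _ _ p0s pis (Us P UP) _ _ _ g01 vE).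
  apply: ler_average => // s; exact: robust_value_le UP vE s.
(* Here [d] may depend on [g]. The chain is: value of [pi], at most that of [d], at most the limit
   of [d] plus [eps / 2], at most the limit of [best] plus [eps / 2], at most the value of [best]
   plus [eps]. *)
have [d dP] := deterministic_optimal (reward M) Us Un Uc hrect g g01.
rewrite lerBlDr; apply: ge_sup => [|_ [pi pis <-]].
  by exists (\sum_s p0 s * value g (deterministic d) s), (deterministic d).
have : \sum_s p0 s * value g pi s <= \sum_s p0 s * value g (deterministic d) s.
  by apply: ler_average => // s; exact: dP.
have := near d; have := near best; have := bestP d; rewrite !ler_norml.
move=> h /andP[h1 h2] /andP[h3 h4] h5; lra.
Qed.
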